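(* Let $C\in\mathrm{Cat}(m,n)$ be realizable with no bottom returns, and let $$S_1=\{(p,q)\in S(C)\mid \iota_{m,n}(p)+\iota_{m,n}(q)\ge 1\},\qquad S_2=S(C)\setminus S_1,$$ $$I_1=\{\iota_{m,n}(q)\mid (p,q)\in S_1\},\quad I_2=\{1,2,\dots,m\}\setminus I_1,\quad I_3=\{\iota_{m,n}(p)\mid(p,q)\in S_2\}.$$ Let $\mathbf b=(b_1,\dots,b_m)$ be the maximal sequence for $C$, and list the elements of $I_2$ in ascending and those of $I_3$ in descending order, $I_2=\{i_1<i_2<\cdots<i_s\}$ and $I_3=\{l_1>l_2>\cdots>l_s\}$, where $s=|S_2|$. Then $$b_j=n\ \text{ for } j\in I_1\qquad\text{and}\qquad b_{i_j}=n+(i_j-1)+l_j\ \text{ for } j=1,2,\dots,s.$$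
   Context: $\mathrm{Cat}(m,n)$ is the set of Catalan states: non-crossing perfect matchings, by arcs embedded in a rectangle, of $2(m+n)$ boundary points: $x_1,\dots,x_n$ on the top side (left to right), $x'_1,\dots,x'_n$ on the bottom side (left to right), $y_1,\dots,y_m$ on the left side and $y'_1,\dots,y'_m$ on the right side (both top to bottom). Extended labels: $x_i=y_{1-i}=y'_{i-n}$ for $1\le i\le n$. A bottom return is an arc joining two bottom points. Realizability. The lattice crossing $L(m,n)$ is the grid of $m$ horizontal lines (joining $y_j$ to $y'_j$) and $n$ vertical lines (joining $x_i$ to $x'_i$). A Kauffman state $s$ assigns a marker $\pm1$ to each crossing: a marker $+1$ smooths the crossing by joining its top half-edge to its right one and its left half-edge to its bottom one; $-1$ joins top to left and bottom to right. $C_s$ is the Catalan state left after discarding closed components. $C$ is realizable if $C=C_s$ for some $s$. Sequences. A sequence $\mathbf{b}=(b_1,\dots,b_m)$ with $0\le b_j\le n$ determines the Kauffman state whose $j$-th row (from the top) has markers $(1,\dots,1,-1,\dots,-1)$ read left to right, with $b_j$ ones followed by $n-b_j$ minus ones; $\mathbf b$ realizes $C$ if this state realizes $C$. $\mathfrak b(C)$ is the set of sequences realizing $C$ (non-empty when $C$ is realizable with no bottom returns), $\Vert\mathbf b\Vert=b_1+\dots+b_m$, $\beta(C)=\max\{\Vert\mathbf b\Vert:\mathbf b\in\mathfrak b(C)\}$; there is a unique $\mathbf b\in\mathfrak b(C)$ with $\Vert\mathbf b\Vert=\beta(C)$, called the maximal sequence of $C$. Coordinates. On top-, left- and right-boundary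 points, $\iota_{m,n}(y'_i)=i$ for $1-n\le i\le m$ (so $\iota_{m,n}(x_i)=i-n$) and $\iota_{m,n}(y_i)=-n+1-i$ for $1\le i\le m$. An arc with neither end on the bottom boundary is written $(p,q)$ with $\iota_{m,n}(p)<\iota_{m,n}(q)$. $S(C)$ is the set of all arcs $(p,q)$ of $C$ with neither $p$ nor $q$ on the bottom boundary. *)

(* Defs.v *)
From HB Require Import structures.
From mathcomp Require Import all_boot all_order all_algebra.
From mathcomp Require Import finmap.

Set Implicit Arguments.
Unset Strict Implicit.
Unset Printing Implicit Defensive.

Import Order.TTheory GRing.Theory Num.Theory.

(* Indices are shifted by one: for i : 'I_n and j : 'I_m (0-based),           *)
(*   Top i = x_{i+1},  Bot i = x'_{i+1},  Lft j = y_{j+1},  Rgt j = y'_{j+1}. *)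
Inductive bpoint (m n : nat) : Type :=
| Top of 'I_n
| Bot of 'I_n
| Lft of 'I_m
| Rgt of 'I_m.
Arguments Top {m n} i.
Arguments Bot {m n} i.
Arguments Lft {m n} j.
Arguments Rgt {m n} j.

Section BpointFinType.
Variables m n : nat.

Definition bpoint_code (p : bpoint m n) : ('I_n + 'I_n) + ('I_m + 'I_m) :=
  match p with
  | Top i => inl (inl i)
  | Bot i => inl (inr i)
  | Lft j => inr (inl j)
  | Rgt j => inr (inr j)
  end.

Definition bpoint_decode (c : ('I_n + 'I_n) + ('I_m + 'I_m)) : bpoint m n :=
  match c with
  | inl (inl i) => Top i
  | inl (inr i) => Bot i
  | inr (inl j) => Lft j
  | inr (inr j) => Rgt j
  end.

Lemma bpoint_codeK : cancel bpoint_code bpoint_decode.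
Proof. by case. Qed.

HB.instance Definition _ := Countable.copy (bpoint m n) (can_type bpoint_codeK).
HB.instance Definition _ : isFinite (bpoint m n) := CanIsFinite bpoint_codeK.

End BpointFinType.

Definition is_bottom (m n : nat) (p : bpoint m n) : bool :=
  if p is Bot _ then true else false.

(* Clockwise rank along the boundary of the rectangle, starting from the      *)
(* bottom left corner: y_m .. y_1, x_1 .. x_n, y'_1 .. y'_m, x'_n .. x'_1.    *)
Definition bpos (m n : nat) (p : bpoint m n) : nat :=
  match p with
  | Lft j => m - j.+1
  | Top i => m + i
  | Rgt j => m + n + j
  | Bot i => m + n + m + (n - i.+1)
  end.

Definition perfect_matching (m n : nat)
    (f : {ffun bpoint m n -> bpoint m n}) : bool :=
  [forall p, (f p != p) && (f (f p) == p)].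

Definition noncrossing (m n : nat)
    (f : {ffun bpoint m n -> bpoint m n}) : bool :=
  [forall p, forall q,
     ~~ [&& bpos p < bpos q, bpos q < bpos (f p) & bpos (f p) < bpos (f q)]].

(* Up to isotopy, a Catalan state is determined by the map sending each       *)
(* boundary point to the other end of its arc.                                *)
Record catalan (m n : nat) := Catalan {
  partner :> {ffun bpoint m n -> bpoint m n};
  partner_matching : perfect_matching partner;
  partner_noncrossing : noncrossing partner
}.

Definition no_bottom_returns (m n : nat) (C : catalan m n) : Prop :=
  forall p : bpoint m n, ~~ (is_bottom p && is_bottom (C p)).

(* Segments of the lattice crossing L(m,n) between consecutive crossings:     *)
(* HSeg j k lies on the j-th horizontal line, just left of its k-th crossing  *)
(* (HSeg j n ends on the right side); VSeg k i lies on the i-th vertical      *)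
(* line, just above its k-th crossing (VSeg m i ends on the bottom side).     *)
Inductive segment (m n : nat) : Type :=
| HSeg of 'I_m & 'I_n.+1
| VSeg of 'I_m.+1 & 'I_n.
Arguments HSeg {m n} j k.
Arguments VSeg {m n} k i.

Section SegmentFinType.
Variables m n : nat.

Definition segment_code (e : segment m n) :
    ('I_m * 'I_n.+1) + ('I_m.+1 * 'I_n) :=
  match e with HSeg j k => inl (j, k) | VSeg k i => inr (k, i) end.

Definition segment_decode (c : ('I_m * 'I_n.+1) + ('I_m.+1 * 'I_n)) :
    segment m n :=
  match c with inl (j, k) => HSeg j k | inr (k, i) => VSeg k i end.

Lemma segment_codeK : cancel segment_code segment_decode.
Proof. by case. Qed.

HB.instance Definition _ := Countable.copy (segment m n) (can_type segment_codeK).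
HB.instance Definition _ : isFinite (segment m n) := CanIsFinite segment_codeK.

End SegmentFinType.

Section Crossing.
Variables (m n : nat) (c : 'I_m * 'I_n).

Definition seg_left : segment m n := HSeg c.1 (widen_ord (leqnSn n) c.2).
Definition seg_right : segment m n := HSeg c.1 (lift ord0 c.2).
Definition seg_above : segment m n := VSeg (widen_ord (leqnSn m) c.1) c.2.
Definition seg_below : segment m n := VSeg (lift ord0 c.1) c.2.

End Crossing.

Definition end_segment (m n : nat) (p : bpoint m n) : segment m n :=
  match p with
  | Top i => VSeg ord0 i
  | Bot i => VSeg ord_max i
  | Lft j => HSeg j ord0
  | Rgt j => HSeg j ord_max
  end.

(* The crossing (j, i) lies on row j and column i; true is the marker +1 and  *)
(* false the marker -1.                                                       *)
Definition kauffman_state (m n : nat) := {ffun 'I_m * 'I_n -> bool}.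

Definition smoothing (m n : nat) (s : kauffman_state m n) (c : 'I_m * 'I_n) :
    seq (segment m n * segment m n) :=
  if s c then [:: (seg_above c, seg_right c); (seg_left c, seg_below c)]
  else [:: (seg_above c, seg_left c); (seg_below c, seg_right c)].

Definition joined (m n : nat) (s : kauffman_state m n) : rel (segment m n) :=
  fun e f =>
    [exists c, ((e, f) \in smoothing s c) || ((f, e) \in smoothing s c)].

(* p and q are the two ends of an arc of C_s. *)
Definition state_arc (m n : nat) (s : kauffman_state m n) :
    rel (bpoint m n) :=
  fun p q => (p != q) && connect (joined s) (end_segment p) (end_segment q).

(* C = C_s *)
Definition state_realizes (m n : nat) (s : kauffman_state m n)
    (C : catalan m n) : bool :=
  [forall p, forall q, (C p == q) == state_arc s p q].

Definition realizable (m n : nat) (C : catalan m n) : Prop :=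
  exists s : kauffman_state m n, state_realizes s C.

(* The entry b j, for j : 'I_m, is b_{j+1}. *)
Definition row_seq (m n : nat) := {ffun 'I_m -> 'I_n.+1}.

Definition row_state (m n : nat) (b : row_seq m n) : kauffman_state m n :=
  [ffun c : 'I_m * 'I_n => c.2 < b c.1].

Definition realizing_seqs (m n : nat) (C : catalan m n) : {set row_seq m n} :=
  [set b | state_realizes (row_state b) C].

Definition seq_norm (m n : nat) (b : row_seq m n) : nat := \sum_(j < m) b j.

Definition beta (m n : nat) (C : catalan m n) : nat :=
  \max_(b in realizing_seqs C) seq_norm b.

Definition maximal_sequence (m n : nat) (C : catalan m n) (b : row_seq m n) :
    Prop :=
  b \in realizing_seqs C /\ seq_norm b = beta C.

Local Open Scope fset_scope.
Local Open Scope ring_scope.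

(* The coordinate is undefined on bottom points; 0 there is a dummy value. *)
Definition iota_mn (m n : nat) (p : bpoint m n) : int :=
  match p with
  | Top i => (i.+1)%:Z - n%:Z
  | Rgt j => (j.+1)%:Z
  | Lft j => - n%:Z + 1 - (j.+1)%:Z
  | Bot _ => 0
  end.

Definition arcsS (m n : nat) (C : catalan m n) :
    {set bpoint m n * bpoint m n} :=
  [set a | [&& C a.1 == a.2, ~~ is_bottom a.1, ~~ is_bottom a.2
             & iota_mn a.1 < iota_mn a.2]].

Definition arcsS1 (m n : nat) (C : catalan m n) :
    {set bpoint m n * bpoint m n} :=
  [set a in arcsS C | 1 <= iota_mn a.1 + iota_mn a.2].

Definition arcsS2 (m n : nat) (C : catalan m n) :
    {set bpoint m n * bpoint m n} :=
  arcsS C :\: arcsS1 C.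

Definition row_label (m : nat) (j : 'I_m) : int := (j.+1)%:Z.

Definition I1 (m n : nat) (C : catalan m n) : {fset int} :=
  [fset iota_mn a.2 | a in arcsS1 C].

Definition I2 (m n : nat) (C : catalan m n) : {fset int} :=
  [fset row_label j | j in 'I_m] `\` I1 C.

Definition I3 (m n : nat) (C : catalan m n) : {fset int} :=
  [fset iota_mn a.1 | a in arcsS2 C].

Definition ascending (A : {fset int}) : seq int := sort <=%R A.
Definition descending (A : {fset int}) : seq int := sort >=%R A.

(* Main.v *)
Require Import Defs.
From mathcomp Require Import all_boot all_order all_algebra.
From mathcomp Require Import finmap zify.

(** Number the boundary points clockwise from the bottom left corner. The
    points off the bottom side get the numbers 0, ..., 2m + n - 1, which are
    their coordinates shifted by m + n - 1; row k (from zero) has the ends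
    m - 1 - k and m + n + k. In a row with b ones followed by minus ones, the
    smoothing joins the strands in positions b and b + 1 (from zero) among the
    n + 2 strands that enter the row, namely its left end, the n strands from
    above and its right end; the other n strands go down in order. So a
    sequence realizes C exactly when every row caps the two ends of an arc of C
    and the n strands that reach the bottom side are matched by C with their
    end points there ([realizes_caps_match], [caps_match_realizes]). Hence a
    realizing sequence amounts to a [schedule]: a bijection from the rows to
    the arcs of S(C) such that both ends of an arc are present in its row and
    an arc comes later than the arcs under it ([caps_schedule],
    [schedule_caps]).

    If row k caps the arc (x, y), x < y, then b_k + D_k = x + k + 1 - m, where
    D_k is the number of ends to the left of x that have been capped before
    ([left_countE]). The right-hand sides have the same sum for all schedules,
    so a sequence is maximal when the sum of the D_k is minimal. Since b_k <= n
    and the row k cannot lie above the end y, one has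
    D_k >= x + y + 1 - 2(m + n), and this bound is the sum of the two
    coordinates minus 1: it is nonnegative exactly on the arcs of S_1. On S_2
    there is the bound D_k >= 0. These bounds depend on the arc only
    ([excess_left_gone]).

    All of them are attained at once by the [greedy] schedule, which caps each
    arc of S_1 in the row where its right end appears and puts the arcs of S_2
    from right to left into the free rows. The only difficulty is that this is
    a schedule ([greedy_schedule]): both ends of an S_2 arc must be present in
    the row it is given, and an S_2 arc under an S_1 arc must come first. Both
    follow by comparing numbers of rows and of arcs: half of the points under
    an arc are left ends ([count_inner]), so the sign of the sum of the
    coordinates tells whether the arcs under it outnumber the rows above its
    right end; and at the left side, the arcs available in the first rows are
    at least as many as these rows because the given sequence fills them.

    Therefore the bounds are equalities for a maximal sequence. On S_1 this
    says that (x, y) is capped in the row of y and that b_k = n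
    ([max_rightward]). On S_2 it says D_k = 0; so b_k = x + k + 1 - m, and no
    arc of S_2 is capped after another one with a smaller left end, that is,
    the arcs of S_2 fill the free rows from right to left
    ([max_free_rows]). *)

Set Implicit Arguments.
Unset Strict Implicit.
Unset Printing Implicit Defensive.

Import Order.TTheory.

(** * Lists of natural numbers *)

Lemma subseq_take_drop (T : eqType) (s : seq T) i j :
  i <= j -> subseq (take i s ++ drop j s) s.
Proof.
move=> hij; rewrite -{3}(cat_take_drop i s) cat_subseq //.
by rewrite -(subnK hij) -drop_drop drop_subseq.
Qed.

Lemma sorted_cons_rcons lo hi s : lo < hi -> sorted ltn s ->
  (forall x, x \in s -> lo < x < hi) -> sorted ltn (lo :: rcons s hi).
Proof.
move=> lohi hs hx; rewrite /= rcons_path path_min_sorted ?hs /=.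
  by have := mem_last lo s; rewrite inE => /predU1P[->//|/hx/andP[]].
by apply/allP=> x /hx/andP[].
Qed.

Lemma take_drop_filter (s : seq nat) i : uniq s -> i.+1 < size s ->
  take i s ++ drop i.+2 s =
  [seq x <- s | ~~ ((x == nth 0 s i) || (x == nth 0 s i.+1))].
Proof.
move=> us hi; have : s = take i s ++ [:: nth 0 s i, nth 0 s i.+1 & drop i.+2 s].
  by rewrite -!drop_nth ?cat_take_drop //; lia.
move: (nth 0 s i) (nth 0 s i.+1) (take i s) (drop i.+2 s) us => p q t u + e.
rewrite e cat_uniq filter_cat /= !inE !eqxx orbT /=.
rewrite !negb_or => /and3P[_ /and3P[pt qt _] /and3P[/andP[_ pu] qu _]].
have fix_filter v : p \notin v -> q \notin v ->
    [seq x <- v | ~~ ((x == p) || (x == q))] = v.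
  move=> hp hq; apply/all_filterP/allP => x hx; rewrite negb_or.
  by apply/andP; split; [apply: contraNneq hp|apply: contraNneq hq] => <-.
by rewrite !fix_filter.
Qed.

Lemma sorted_nth_gap (s : seq nat) i x : sorted ltn s -> i.+1 < size s ->
  x \in s -> ~~ (nth 0 s i < x < nth 0 s i.+1).
Proof.
move=> hs hi /(nthP 0)[j hj ej]; have {ej}<- : nth 0 s j = x := ej.
have mono a b : b < size s -> a < b -> nth 0 s a < nth 0 s b.
  move=> hb hab; apply: (sorted_ltn_nth ltn_trans 0 hs) => //.
  exact: ltn_trans hab hb.
apply/negP => /andP[h1 h2]; case: (ltngtP j i) => hji.
- by have := mono j i (ltnW hi) hji; lia.
- case: (ltngtP j i.+1) => hji'; first lia.
    by have := mono i.+1 j hj hji'; lia.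
  by rewrite hji' ltnn in h2.
by rewrite hji ltnn in h1.
Qed.

(** There are only n values available, so a strictly decreasing function
    takes all of them. *)
Lemma decreasing_onto (N n : nat) (f : nat -> nat) :
  (forall i, i < n -> N <= f i < N + n) ->
  (forall i, i.+1 < n -> f i.+1 < f i) ->
  forall i, i < n -> f i = N + (n - i.+1).
Proof.
move=> hf hd.
have up i : i < n -> f i + i < N + n.
  elim: i => [|i IH] hi; first by have := hf 0 hi; lia.
  by have := hd i hi; have := IH (ltnW hi); lia.
have lo d i : i + d.+1 = n -> N + d <= f i.
  elim: d i => [|d IH] i hi; first by have := hf i; lia.
  by have := hd i; have := IH i.+1; lia.
by move=> i hi; have := up i hi; have := lo (n - i.+1) i; lia.
Qed.

Lemma count_split (T : Type) (a b : pred T) (s : seq T) :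
  count (fun x => a x && b x) s + count (fun x => a x && ~~ b x) s = count a s.
Proof. by elim: s => //= x s <-; case: (a x); case: (b x) => /=; lia. Qed.

Lemma count_ltn_iota p lo len :
  count (fun x => x < p) (iota lo len) = minn (p - lo) len.
Proof. by elim: len lo => [|len IH] lo /=; rewrite ?IH; lia. Qed.

Lemma count_sub (T : eqType) (a b : pred T) (s : seq T) :
  (forall x, x \in s -> a x -> b x) -> count a s <= count b s.
Proof.
elim: s => //= x s IH h; apply: leq_add; last first.
  by apply: IH => y hy; apply: h; rewrite inE hy orbT.
by have := h x (mem_head _ _); case: (a x) => // ->.
Qed.

Lemma count_sub_lt (T : eqType) (a b : pred T) (s : seq T) x :
  x \in s -> ~~ a x -> b x -> (forall y, y \in s -> a y -> b y) ->
  count a s < count b s.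
Proof.
move=> hx nax bx h; have <- := count_split b a s.
have -> : count (fun y => b y && a y) s = count a s.
  apply: eq_in_count => y hy /=; case ay: (a y); last by rewrite andbF.
  by rewrite (h _ hy).
rewrite -[X in X < _]addn0 ltn_add2l -has_count; apply/hasP.
by exists x; rewrite ?bx.
Qed.

(** * The strands of a row sequence *)

Section Rows.
Variables m n : nat.

Definition row_ends (S : seq nat) (k : nat) : seq nat :=
  (m - k.+1) :: rcons S (m + n + k).

(** The strands between rows k - 1 and k, from left to right, each named by
    the boundary point where it starts; row k caps the entries b k and b k +
    1 of its incoming strands. *)
Fixpoint strands (b : nat -> nat) (k : nat) : seq nat :=
  if k is k'.+1 then
    let T := row_ends (strands b k') k' in take (b k') T ++ drop (b k').+2 T
  else iota m n.

Definition incoming (b : nat -> nat) (k : nat) := row_ends (strands b k) k.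

Lemma strandsS b k :
  strands b k.+1 = take (b k) (incoming b k) ++ drop (b k).+2 (incoming b k).
Proof. by []. Qed.

Lemma size_incoming b k : size (incoming b k) = (size (strands b k)).+2.
Proof. by rewrite /incoming /row_ends /= size_rcons. Qed.

Lemma size_strands b k :
  (forall j, j < k -> b j <= n) -> size (strands b k) = n.
Proof.
elim: k => [|k IH] hb; first by rewrite size_iota.
have hS : size (strands b k) = n by apply: IH => j hj; apply: hb; lia.
have := hb k (ltnSn k).
rewrite strandsS size_cat size_take size_drop size_incoming hS; case: ifP; lia.
Qed.

Lemma nth_strandsS b k i : (forall j, j <= k -> b j <= n) ->
  nth 0 (strands b k.+1) i =
  if i < b k then nth 0 (incoming b k) i else nth 0 (incoming b k) i.+2.
Proof.
move=> hb; rewrite strandsS nth_cat size_take size_incoming size_strands; last first.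
  by move=> j hj; apply: hb; lia.
have -> : b k < n.+2 by have := hb k (leqnn k); lia.
case: ifP => hi; first by rewrite nth_take.
by rewrite nth_drop; congr nth; lia.
Qed.

Lemma nth_incoming b k i : (forall j, j < k -> b j <= n) -> i <= n.+1 ->
  nth 0 (incoming b k) i =
  if i is i'.+1 then if i' < n then nth 0 (strands b k) i' else m + n + k
  else m - k.+1.
Proof.
move=> hb hi; case: i hi => //= i hi.
rewrite nth_rcons size_strands //; case: ltngtP => //; lia.
Qed.

(** Each end that has appeared either still runs down or has been capped; for
    k = m this accounts for all points off the bottom side. *)
Lemma strands_cover b k x : (forall j, j < k -> b j <= n) -> k <= m ->
  m - k <= x < m + n + k ->
  x \in strands b k \/
  exists2 j, j < k & x = nth 0 (incoming b j) (b j) \/ x = nth 0 (incoming b j) (b j).+1.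
Proof.
elim: k x => [|k IH] x hb hk hx; first by left; rewrite mem_iota; lia.
have hb' j : j < k -> b j <= n by move=> hj; apply: hb; lia.
have [|[j hj hx']] : x \in incoming b k \/ exists2 j, j < k &
   x = nth 0 (incoming b j) (b j) \/ x = nth 0 (incoming b j) (b j).+1.
  case E: (x \in incoming b k); first by left.
  right; case: (IH x hb'); [lia| | | by []].
    move: E; rewrite /incoming /row_ends inE mem_rcons inE; lia.
  by move=> h; move: E; rewrite /incoming /row_ends inE mem_rcons inE h !orbT.
- case/(nthP 0) => i; rewrite size_incoming size_strands // => hi <-.
  have hbk := hb k (ltnSn k).
  case: (ltngtP i (b k)) => hib; last by right; exists k => //; left; rewrite hib.
    left; have <- : nth 0 (strands b k.+1) i = nth 0 (incoming b k) i.
      by rewrite nth_strandsS ?hib.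
    by apply: mem_nth; rewrite size_strands //; lia.
  case: (eqVneq i (b k).+1) => [->|hne]; first by right; exists k => //; right.
  left; have <- : nth 0 (strands b k.+1) i.-2 = nth 0 (incoming b k) i.
    rewrite nth_strandsS //; case: ifP; first lia.
    by move=> _; congr nth; lia.
  by apply: mem_nth; rewrite size_strands //; lia.
- by right; exists j => //; lia.
Qed.

Lemma strands_range b k x : (forall j, j < k -> b j <= n) -> k <= m ->
  x \in strands b k -> m - k <= x < m + n + k.
Proof.
elim: k x => [|k IH] x hb hk; first by rewrite mem_iota; lia.
rewrite strandsS => hx.
have : x \in incoming b k by move: hx; rewrite mem_cat => /orP[/mem_take|/mem_drop].
rewrite /incoming /row_ends inE mem_rcons inE => /or3P[/eqP->|/eqP->|]; try lia.
by move/IH => h; have := h (fun j hj => hb j (ltnW hj)) (ltnW hk); lia.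
Qed.

Lemma incoming_range b k x : (forall j, j < k -> b j <= n) -> k < m ->
  x \in incoming b k -> m - k.+1 <= x <= m + n + k.
Proof.
move=> hb hk; rewrite /incoming /row_ends inE mem_rcons inE => /or3P[/eqP->|/eqP->|].
- lia.
- lia.
by move/strands_range => h; have := h hb (ltnW hk); lia.
Qed.

Lemma incoming_sorted b k : (forall j, j < k -> b j <= n) -> k < m ->
  sorted ltn (incoming b k).
Proof.
move=> + hk; rewrite /incoming; elim: k hk => [|k IH] hk hb.
  apply: sorted_cons_rcons; rewrite ?iota_ltn_sorted //; first lia.
  by move=> x; rewrite mem_iota; lia.
apply: sorted_cons_rcons; first lia.
  apply: subseq_sorted (IH _ _); [exact: ltn_trans| |lia|by move=> j hj; apply: hb; lia].
  by apply: subseq_take_drop; rewrite 2?leqW.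
by move=> x /strands_range -/(_ hb (ltnW hk)); lia.
Qed.

Lemma strands_sorted b k : (forall j, j < k -> b j <= n) -> k <= m ->
  sorted ltn (strands b k).
Proof.
case: k => [|k] hb hk; first exact: iota_ltn_sorted.
apply: subseq_sorted (incoming_sorted _ hk); first exact: ltn_trans.
  by apply: subseq_take_drop; rewrite 2?leqW.
by move=> j hj; apply: hb; lia.
Qed.

End Rows.

(** * Boundary points as numbers *)

Section Boundary.
Variables (m n : nat).

Lemma bpos_inj : injective (@bpos m n).
Proof.
case=> i [] j /=; have hi := ltn_ord i; have hj := ltn_ord j => h;
  try (exfalso; lia); congr (_ _); apply: val_inj => /=; lia.
Qed.

Lemma bpos_ltn (p : bpoint m n) : bpos p < m + n + m + n.
Proof. by case: p => i /=; have := ltn_ord i; lia. Qed.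

Lemma bpos_bottom (p : bpoint m n) : is_bottom p = (m + n + m <= bpos p).
Proof. by case: p => i /=; have := ltn_ord i; lia. Qed.

Lemma bpos_surj x : x < m + n + m + n -> exists p : bpoint m n, bpos p = x.
Proof.
move=> hx; case: (ltnP x m) => h1.
  have h : m - x.+1 < m by lia.
  by exists (Lft (Ordinal h)) => /=; lia.
case: (ltnP x (m + n)) => h2.
  have h : x - m < n by lia.
  by exists (Top (Ordinal h)) => /=; lia.
case: (ltnP x (m + n + m)) => h3.
  have h : x - (m + n) < m by lia.
  by exists (Rgt (Ordinal h)) => /=; lia.
have h : n - (x - (m + n + m)).+1 < n by lia.
by exists (Bot (Ordinal h)) => /=; lia.
Qed.

Variable C : catalan m n.

(** The matching C read on clockwise numbers; the value 0 is only taken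
    outside the range of the numbering. *)
Definition mate (x : nat) : nat :=
  if [pick p | bpos p == x] is Some p then bpos (C p) else 0.

Lemma mate_bpos p : mate (bpos p) = bpos (C p).
Proof.
rewrite /mate; case: pickP => [q /eqP/bpos_inj->//|/(_ p)]; by rewrite eqxx.
Qed.

Lemma mate_ltn x : x < m + n + m + n -> mate x < m + n + m + n.
Proof. by move=> /bpos_surj[p <-]; rewrite mate_bpos bpos_ltn. Qed.

Lemma mateK x : x < m + n + m + n -> mate (mate x) = x.
Proof.
move=> /bpos_surj[p <-]; rewrite !mate_bpos.
by have /forallP/(_ p)/andP[_ /eqP->] := partner_matching C.
Qed.

Lemma mate_neq x : x < m + n + m + n -> mate x <> x.
Proof.
move=> /bpos_surj[p <-]; rewrite !mate_bpos => /bpos_inj e.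
by have /forallP/(_ p)/andP[] := partner_matching C; rewrite e eqxx.
Qed.

(** The noncrossing condition of a state excludes one pattern p < q < C p < C
    q; applied to (x, y) and to (C y, x), it leaves no other place for C y. *)
Lemma mate_nested x y : x < y < mate x -> y < m + n + m + n ->
  x < mate y < mate x.
Proof.
move=> hxy hy; have hx : x < m + n + m + n by lia.
have hyx : mate y <> mate x.
  by move=> e; have := mateK hx; rewrite -e mateK //; lia.
have hyx' : mate y <> x by move=> e; have := mateK hy; rewrite e; lia.
have cross p q : p < m + n + m + n -> q < m + n + m + n ->
    p < q -> q < mate p -> mate p < mate q -> False.
  move=> /bpos_surj[p' <-] /bpos_surj[q' <-]; rewrite !mate_bpos => h1 h2 h3.
  have /forallP/(_ p')/forallP/(_ q') := partner_noncrossing C.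
  by rewrite h1 h2 h3.
have hmy := mate_ltn hy.
case: (ltngtP (mate y) x) => h1 //.
  by case: (cross (mate y) x) => //; rewrite mateK //; lia.
case: (ltngtP (mate y) (mate x)) => h2 //.
by case: (cross x y) => //; lia.
Qed.

Lemma mate_bottom x : no_bottom_returns C ->
  m + n + m <= x < m + n + m + n -> mate x < m + n + m.
Proof.
move=> hC /andP[h1 /bpos_surj[p hp]]; subst x; rewrite mate_bpos ltnNge.
by have := hC p; rewrite !bpos_bottom h1.
Qed.

End Boundary.

(** * States of row sequences *)

Section State.
Variables (m n : nat) (r : row_seq m n).
Local Notation state := (row_state r).

Definition row_nat (k : nat) : nat :=
  oapp (fun j : 'I_m => (r j : nat)) 0 (insub k).

Lemma row_nat_ord (j : 'I_m) : row_nat j = r j.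
Proof. by rewrite /row_nat valK. Qed.

Lemma row_nat_leq k : row_nat k <= n.
Proof. by rewrite /row_nat; case: insub => [j|] //=; rewrite -ltnS. Qed.

Lemma joined_sym : symmetric (joined state).
Proof. by move=> e f; apply: eq_existsb => c; rewrite orbC. Qed.

Lemma joined_above (j : 'I_m) (i : 'I_n) (a : 'I_m.+1) (k : 'I_n.+1) :
  a = j :> nat -> k = i + (i < r j) :> nat -> joined state (VSeg a i) (HSeg j k).
Proof.
move=> ha hk; apply/existsP; exists (j, i); apply/orP; left.
rewrite /smoothing ffunE /=.
have -> : a = widen_ord (leqnSn m) j by apply: val_inj.
case: ltnP hk => h hk; rewrite inE; apply/orP; left; apply/eqP; congr (_, HSeg _ _);
  apply: val_inj; rewrite /= /bump; lia.
Qed.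

Lemma joined_below (j : 'I_m) (i : 'I_n) (d : 'I_m.+1) (k : 'I_n.+1) :
  d = j.+1 :> nat -> k = i + (r j <= i) :> nat ->
  joined state (HSeg j k) (VSeg d i).
Proof.
move=> hd hk; apply/existsP; exists (j, i); apply/orP.
rewrite /smoothing ffunE /=.
have -> : d = lift ord0 j by apply: val_inj; rewrite /= /bump.
case: ltnP hk => h hk; [left|right]; rewrite !inE; apply/orP; right; apply/eqP.
  congr (HSeg _ _, _); apply: val_inj => /=; lia.
by congr (_, HSeg _ _); apply: val_inj; rewrite /= /bump; lia.
Qed.

(** The two markers are treated together: in column i the vertical segment
    above row j turns into the horizontal segment i + (i < r j), and the one
    below comes from the segment i + (r j <= i). *)
Lemma joined_ind (P : segment m n -> segment m n -> Prop) :
  (forall e f, P e f -> P f e) ->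
  (forall (j : 'I_m) (i : 'I_n) (a : 'I_m.+1) (k : 'I_n.+1),
     a = j :> nat -> k = i + (i < r j) :> nat -> P (VSeg a i) (HSeg j k)) ->
  (forall (j : 'I_m) (i : 'I_n) (d : 'I_m.+1) (k : 'I_n.+1),
     d = j.+1 :> nat -> k = i + (r j <= i) :> nat -> P (HSeg j k) (VSeg d i)) ->
  forall e f, joined state e f -> P e f.
Proof.
move=> Psym Pa Pb e f /existsP[[j i]].
wlog : e f / (e, f) \in smoothing state (j, i) => [hw|].
  by case/orP=> h; [|apply: Psym]; apply: hw; rewrite ?h.
rewrite /smoothing ffunE /=; case: ltnP => h + _; rewrite !inE.
  case/orP=> /eqP[-> ->]; [apply: Pa|apply: Pb]; rewrite /= /bump; lia.
case/orP=> /eqP[-> ->]; [apply: Pa|apply/Psym/Pb]; rewrite /= /bump; lia.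
Qed.

Definition reaches (e : segment m n) (x : nat) : Prop :=
  exists2 p, bpos p = x & connect (joined state) e (end_segment p).

Lemma reaches_end p : reaches (end_segment p) (bpos p).
Proof. by exists p. Qed.

Lemma reaches_joined e f x : joined state e f -> reaches e x -> reaches f x.
Proof.
move=> h [p hp hc]; exists p => //; apply: connect_trans hc.
by rewrite connect1 // joined_sym.
Qed.


Local Notation T k := (incoming m n row_nat k).
Local Notation S k := (strands m n row_nat k).
Let hb k : row_nat k <= n := row_nat_leq k.

(** Left of position r j the horizontal segments continue strands shifted one
    step to the right, right of it strands shifted to the left; the segment
    in position r j itself lies on two strands, which are thereby capped. *)
Lemma reaches_row (j : 'I_m) (k : 'I_n.+1) :
  (forall (a : 'I_m.+1) i, a = j :> nat -> reaches (VSeg a i) (nth 0 (S j) i)) ->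
  (k <= r j -> reaches (HSeg j k) (nth 0 (T j) k)) /\
  (r j <= k -> reaches (HSeg j k) (nth 0 (T j) k.+1)).
Proof.
move=> hS; have hk := ltn_ord k; have hj := ltn_ord j.
have ha : j < m.+1 by lia.
have [hS' hrj] := (hS (Ordinal ha), ltn_ord (r j)).
split=> hkr; rewrite nth_incoming //; try lia.
- case: k hk hkr => [[|i] /= hk' hk hkr].
    have := reaches_end (Lft j); congr (reaches (HSeg _ _) _); exact: val_inj.
  have hi : i < n by lia.
  rewrite hi; apply: reaches_joined (hS' (Ordinal hi) erefl).
  by apply: joined_above => //=; lia.
- case: ltnP => hkn.
    apply: reaches_joined (hS' (Ordinal hkn) erefl).
    by apply: joined_above => //=; lia.
  have := reaches_end (Rgt j); congr (reaches (HSeg _ _) _).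
  by apply: val_inj => /=; lia.
Qed.

Lemma reaches_strand k (a : 'I_m.+1) i :
  a = k :> nat -> reaches (VSeg a i) (nth 0 (S k) i).
Proof.
elim: k a i => [|k IH] a i ha.
  rewrite /= nth_iota ?ltn_ord //.
  by have := reaches_end (Top i); congr (reaches (VSeg _ _) _); apply: val_inj.
have hk : k < m by have := ltn_ord a; lia.
have hR (k' : 'I_n.+1) := @reaches_row (Ordinal hk) k' IH.
have hi := ltn_ord i.
rewrite nth_strandsS // (row_nat_ord (Ordinal hk)).
case: ltnP => hir.
  have [hk' _] := hR (widen_ord (leqnSn n) i).
  apply: reaches_joined (hk' (ltnW hir)); apply: joined_below => //=; lia.
have [_ hk'] := hR (lift ord0 i); rewrite /= /bump in hk'.
apply: reaches_joined (hk' (leqW hir)); apply: joined_below => //=.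
rewrite /bump; lia.
Qed.

Lemma reaches_cap (j : 'I_m) :
  reaches (HSeg j (r j)) (nth 0 (T j) (r j)) /\
  reaches (HSeg j (r j)) (nth 0 (T j) (r j).+1).
Proof.
have [h1 h2] := @reaches_row j (r j) (@reaches_strand j).
by split; [apply: h1|apply: h2].
Qed.

Lemma reaches_arc e x y : x != y -> reaches e x -> reaches e y ->
  exists p q, [/\ bpos p = x, bpos q = y & state_arc state p q].
Proof.
move=> hxy [p hp hcp] [q hq hcq]; exists p, q; split=> //.
rewrite /state_arc; apply/andP; split.
  by apply: contraNneq hxy => pq; rewrite -hp -hq pq.
by apply: connect_trans hcq; rewrite (sym_connect_sym joined_sym).
Qed.

Variable C : catalan m n.
Hypothesis hC : no_bottom_returns C.
Local Notation c := (mate C).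
Local Notation N := (m + n + m).

(** Local form of realizability: each row caps an arc of C, and the strands
    at the bottom end where C wants them. *)
Definition caps_match :=
  (forall k, k < m ->
     c (nth 0 (T k) (row_nat k)) = nth 0 (T k) (row_nat k).+1) /\
  (forall i, i < n -> c (nth 0 (S m) i) = N + (n - i.+1)).

Lemma nth_incoming_lt k : k < m ->
  nth 0 (T k) (row_nat k) < nth 0 (T k) (row_nat k).+1.
Proof.
move=> hk; apply: (sorted_ltn_nth ltn_trans 0 (incoming_sorted _ hk)) => //.
all: by rewrite inE size_incoming size_strands // ?ltnS // leqW.
Qed.

Lemma incoming_ltn k i : k < m -> i < n.+2 -> nth 0 (T k) i < N.
Proof.
move=> hk hi; have : nth 0 (T k) i \in T k.
  by rewrite mem_nth // size_incoming size_strands.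
by move/incoming_range => /(_ (fun j _ => hb j) hk); lia.
Qed.

Lemma strand_ltn i : i < n -> nth 0 (S m) i < N.
Proof.
move=> hi; have : nth 0 (S m) i \in S m by rewrite mem_nth // size_strands.
by move/strands_range => /(_ (fun j _ => hb j) (leqnn m)); lia.
Qed.

Lemma realizes_caps_match : state_realizes state C -> caps_match.
Proof.
move=> /forallP hr.
have arcE x y e : x != y -> reaches e x -> reaches e y -> c x = y.
  move=> hxy hx hy; have [p [q [<- <- h]]] := reaches_arc hxy hx hy.
  by rewrite mate_bpos; move: (hr p) => /forallP/(_ q); rewrite h eqb_id => /eqP->.
split=> [k hk|i hi].
  have [h1 h2] := reaches_cap (Ordinal hk).
  rewrite (row_nat_ord (Ordinal hk)); apply: arcE h1 h2.
  by have := nth_incoming_lt hk; rewrite (row_nat_ord (Ordinal hk)) /=; lia.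
have h := @reaches_strand m ord_max (Ordinal hi) erefl.
have h' := reaches_end (Bot (Ordinal hi)).
by apply: arcE h h'; have := strand_ltn hi; rewrite /=; lia.
Qed.

(** The segment in position r j of row j belongs to both strands capped
    there; the left one is chosen. *)
Definition strand_of (e : segment m n) : nat :=
  match e with
  | HSeg j k => nth 0 (T j) (if k <= r j then (k : nat) else k.+1)
  | VSeg k i => nth 0 (S k) i
  end.

(** A name for the arc through x that does not depend on the chosen end. *)
Definition arc_key x := minn x (c x).

Lemma arc_key_cap k : caps_match -> k < m ->
  arc_key (nth 0 (T k) (row_nat k)) = arc_key (nth 0 (T k) (row_nat k).+1).
Proof.
move=> [hcap _] hk; rewrite /arc_key -hcap // mateK 1?minnC //.
have := @incoming_ltn k (row_nat k) hk; have := hb k; lia.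
Qed.

(** The key of the strand is invariant along every smoothed crossing: all
    joins continue one strand, except for the caps, which by hypothesis join
    the two ends of one arc. So distinct arcs of C are not connected in the
    state. *)
Lemma connect_arc_key e f : caps_match -> connect (joined state) e f ->
  arc_key (strand_of e) = arc_key (strand_of f).
Proof.
move=> hcap /connectP[p hp ->]; elim: p e hp => //= g p IH e /andP[heg /IH<-].
move: e g heg {IH}; apply: joined_ind => // j i a k ha hk;
  rewrite /strand_of hk ha.
  have := arc_key_cap hcap (ltn_ord j); rewrite row_nat_ord.
  have -> : nth 0 (S j) i = nth 0 (T j) i.+1.
    by rewrite nth_incoming ?ltn_ord //; have := ltn_ord i; lia.
  case: (ltngtP i (r j)) => h he; rewrite ?addn0 ?addn1 ?h //=.
  - by rewrite leqNgt h.
  - by rewrite leqnn he.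
rewrite nth_strandsS // row_nat_ord.
by case: ltnP => h; rewrite ?addn0 ?addn1 ?(ltnW h) // leqNgt ltnS h.
Qed.

Lemma arc_key_end p : caps_match ->
  arc_key (strand_of (end_segment p)) = arc_key (bpos p).
Proof.
move=> hcap; case: p => i; have hi := ltn_ord i.
- by rewrite /= nth_iota.
- rewrite /arc_key /= -(proj2 hcap i hi) mateK 1?minnC //.
  by have := strand_ltn hi; lia.
- by rewrite /=; congr arc_key; lia.
rewrite /strand_of /= -/(incoming m n row_nat i).
have hn : nth 0 (T i) n.+1 = m + n + i by rewrite nth_incoming // ltnn.
case: ifP => h; last by rewrite hn.
have e : row_nat i = n by apply/eqP; rewrite eqn_leq hb row_nat_ord.
by have := arc_key_cap hcap hi; rewrite e hn.
Qed.

(** An end off the bottom side is capped in some row or reaches the bottom;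
    in both cases the segment there leads to the other end of its arc. *)
Lemma reaches_mate x : caps_match -> x < N ->
  exists2 e, reaches e x & reaches e (c x).
Proof.
move=> [hcap hend] hx.
have hx' : m - m <= x < m + n + m by lia.
have [|[k hk hkx]] := strands_cover (fun j _ => hb j) (leqnn m) hx'.
  case/(nthP 0) => i; rewrite size_strands // => hi <-; rewrite hend //.
  exists (VSeg ord_max (Ordinal hi)); first exact: reaches_strand.
  exact: reaches_end (Bot (Ordinal hi)).
have [h1 h2] := reaches_cap (Ordinal hk).
have hc : c (nth 0 (T k) (row_nat k).+1) = nth 0 (T k) (row_nat k).
  rewrite -hcap // mateK //; have := @incoming_ltn k (row_nat k) hk.
  by have := hb k; lia.
exists (HSeg (Ordinal hk) (r (Ordinal hk)));
  case: hkx => ->; rewrite ?hc ?hcap // (row_nat_ord (Ordinal hk)) //.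
Qed.

Lemma caps_match_realizes : caps_match -> state_realizes state C.
Proof.
move=> hcap; apply/forallP => p; apply/forallP => q.
apply/eqP; apply/idP/idP.
  move=> /eqP <-; have hp := bpos_ltn p.
  have hne : bpos p != c (bpos p) by apply/eqP => e; exact: (mate_neq hp (esym e)).
  have [e he1 he2] : exists2 e, reaches e (bpos p) & reaches e (c (bpos p)).
    case: (ltnP (bpos p) N) => hpN; first exact: reaches_mate.
    have h : c (bpos p) < N by apply: mate_bottom => //; rewrite hpN.
    have [e] := reaches_mate hcap h; rewrite mateK // => h1 h2.
    by exists e.
  have [p' [q' [/bpos_inj-> + h]]] := reaches_arc hne he1 he2.
  by rewrite mate_bpos => /bpos_inj <-.
case/andP=> hpq /(connect_arc_key hcap); rewrite !arc_key_end // /arc_key !mate_bpos.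
have CK p' : C (C p') = p'.
  by have /forallP/(_ p')/andP[_ /eqP->] := partner_matching C.
case: (leqP (bpos p)) => _; case: (leqP (bpos q)) => _ /bpos_inj e.
- by rewrite e eqxx in hpq.
- by rewrite e CK.
- by rewrite e.
- by move: hpq; rewrite -(CK p) e CK eqxx.
Qed.

End State.

(** * Non-crossing matchings *)

Section Matching.
Variables (m n : nat) (c : nat -> nat).
Local Notation N := (m + n + m).
Hypothesis cK : forall x, x < N + n -> c (c x) = x.
Hypothesis c_ltn : forall x, x < N + n -> c x < N + n.
Hypothesis c_neq : forall x, x < N + n -> c x <> x.
Hypothesis c_nested : forall x y, x < y < c x -> y < N + n -> x < c y < c x.

Definition openers := [seq x <- iota 0 N | x < c x < N].

Lemma mem_openers x : (x \in openers) = (x < c x < N).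
Proof. rewrite mem_filter mem_iota; lia. Qed.

Lemma openers_inner x y : x \in openers -> x < y < c x ->
  (y \in openers) || (c y \in openers).
Proof.
rewrite !mem_openers => hx hy; have hyN : y < N + n by lia.
have := c_nested hy hyN; have := cK hyN; have := c_neq hyN.
by move=> ne -> ?; lia.
Qed.

Definition gone (P : nat -> nat) (k x : nat) : bool :=
  has (fun j => (x == P j) || (x == c (P j))) (iota 0 k).

Lemma goneP (P : nat -> nat) k x :
  reflect (exists2 j, j < k & x = P j \/ x = c (P j)) (gone P k x).
Proof.
apply: (iffP hasP) => [[j]|[j hj h]].
  by rewrite mem_iota => hj /orP[] /eqP ->; exists j => //; auto.
by exists j; rewrite ?mem_iota //; case: h => <-; rewrite eqxx ?orbT.
Qed.

Lemma goneS P k x :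
  gone P k.+1 x = gone P k x || (x == P k) || (x == c (P k)).
Proof. by rewrite /gone -addn1 iotaD has_cat /= orbF orbA. Qed.

(** * Schedules *)

(** P k is the left end of the arc capped in row k. The ends m - 1 - k and m
    + n + k appear in row k, whence the two bounds; an arc can be capped only
    after everything under it has gone. *)
Record schedule (P : nat -> nat) : Prop := Schedule {
  sched_perm : perm_eq (map P (iota 0 m)) openers;
  sched_reach : forall k, k < m -> m <= P k + k.+1 /\ c (P k) <= m + n + k;
  sched_nest : forall j k, j < m -> k < m -> P k < P j < c (P k) -> j < k
}.

Definition caps_arc (b P : nat -> nat) (k : nat) : Prop :=
  [/\ b k <= n, nth 0 (incoming m n b k) (b k) = P k
    & nth 0 (incoming m n b k) (b k).+1 = c (P k)].

(** The strands above a row are the ends that have appeared and are not yet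
    gone, in their order along the boundary; this removes the recursion from
    the description of a row sequence. *)
Lemma strands_filter b P k : k <= m ->
  (forall j, j < k -> caps_arc b P j) ->
  strands m n b k = [seq x <- iota (m - k) (n + k + k) | ~~ gone P k x] /\
  (k < m -> incoming m n b k =
     [seq x <- iota (m - k.+1) (n + k + k + 2) | ~~ gone P k x]).
Proof.
have step k' : k' < m -> (forall j, j < k' -> caps_arc b P j) ->
    strands m n b k' = [seq x <- iota (m - k') (n + k' + k') | ~~ gone P k' x] ->
    incoming m n b k' =
      [seq x <- iota (m - k'.+1) (n + k' + k' + 2) | ~~ gone P k' x].
  move=> hk' hcap hS.
  have hb j : j < k' -> b j <= n by move=> /hcap[].
  have new x : x < m - k' \/ m + n + k' <= x -> ~~ gone P k' x.
    move=> hx; apply/goneP => -[j hj hxj]; have [h0 h1 h2] := hcap j hj.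
    have /incoming_range hr : x \in incoming m n b j.
      by case: hxj => ->; rewrite -?h2 -?h1 mem_nth // size_incoming size_strands;
        try lia; move=> i hi; apply: hb; lia.
    by have := hr (fun i hi => hb i (ltn_trans hi hj)) (ltn_trans hj hk'); lia.
  rewrite /incoming /row_ends hS (_ : n + k' + k' + 2 = (n + k' + k' + 1).+1);
    last lia.
  rewrite [iota _ _.+1]/= (_ : (m - k'.+1).+1 = m - k'); last lia.
  rewrite (iotaD _ _ 1) (_ : m - k' + _ = m + n + k'); last lia.
  by rewrite -cats1 /= filter_cat /= !new //; [right|left; lia].
elim: k => [|k IH] hk hcap.
  have e : strands m n b 0 = [seq x <- iota (m - 0) (n + 0 + 0) | ~~ gone P 0 x].
    by rewrite /= filter_predT subn0 !addn0.
  by split=> // hk'; apply: step.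
have [|hS /(_ hk) hT] := IH (ltnW hk); first by move=> j hj; apply: hcap; lia.
have e : strands m n b k.+1 =
    [seq x <- iota (m - k.+1) (n + k.+1 + k.+1) | ~~ gone P k.+1 x].
  have [h0 h1 h2] := hcap k (ltnSn k).
  have hsz : size (incoming m n b k) = n.+2.
    by rewrite size_incoming size_strands // => j hj; have [] := hcap j (leqW hj).
  have hso : sorted ltn (incoming m n b k).
    by apply: incoming_sorted => // j hj; have [] := hcap j (leqW hj).
  rewrite strandsS take_drop_filter ?hsz //; last first.
    exact: sorted_uniq ltn_trans ltnn _ hso.
  rewrite h1 h2 hT -filter_predI (_ : n + k + k + 2 = n + k.+1 + k.+1); last lia.
  by apply: eq_filter => x /=; rewrite goneS !negb_or andbC andbA.
by split=> // hk'; apply: step.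
Qed.

(** The interval of the ends that have appeared when row k is smoothed, so
    that each end to the left of P k is counted if it satisfies a. *)
Definition below_count (a : pred nat) (P : nat -> nat) (k : nat) : nat :=
  count (fun x => (x < P k) && a x) (iota (m - k.+1) (n + k + k + 2)).

Definition left_alive P k := below_count (fun x => ~~ gone P k x) P k.
Definition left_gone P k := below_count (gone P k) P k.

Lemma left_countE P k : schedule P -> k < m ->
  left_alive P k + left_gone P k + m = P k + k.+1.
Proof.
move=> hP hk; have [h1 h2] := sched_reach hP hk.
have := mem_openers (P k); rewrite -(perm_mem (sched_perm hP)) map_f ?mem_iota //.
move=> /esym/andP[h3 h4].
rewrite addnC addnA addnC /left_alive /left_gone /below_count addnCA.
rewrite [X in _ + X]count_split count_ltn_iota; lia.
Qed.

Lemma sched_inj P : schedule P -> forall j k, j < m -> k < m ->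
  P j = P k -> j = k.
Proof.
move=> hP j k hj hk e.
have u : uniq (map P (iota 0 m)).
  by rewrite (perm_uniq (sched_perm hP)) filter_uniq ?iota_uniq.
have := nth_uniq 0 _ _ u; rewrite size_map size_iota => /(_ j k hj hk).
by rewrite !(nth_map 0) ?size_iota // !nth_iota // e eqxx => /esym/eqP.
Qed.

Lemma sched_opener P k : schedule P -> k < m -> P k < c (P k) < N.
Proof.
by move=> hP hk; rewrite -mem_openers -(perm_mem (sched_perm hP)) map_f ?mem_iota.
Qed.

Lemma sched_onto P x : schedule P -> x \in openers ->
  exists2 k, k < m & x = P k.
Proof.
move=> hP; rewrite -(perm_mem (sched_perm hP)) => /mapP[k].
by rewrite mem_iota => hk ->; exists k.
Qed.

(** The position of an end in a sorted list of strands is the number of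
    strands to its left. *)
Lemma caps_alive b P k : k < m ->
  (forall j, j <= k -> caps_arc b P j) -> b k = left_alive P k.
Proof.
move=> hk hcap; have [h0 h1 h2] := hcap k (leqnn k).
have hb j : j < k -> b j <= n by move=> hj; have [] := hcap j (ltnW hj).
have [_ /(_ hk) hT] := strands_filter (ltnW hk) (fun j hj => hcap j (ltnW hj)).
have hsz : size (incoming m n b k) = n.+2 by rewrite size_incoming size_strands.
have := @count_lt_nth _ _ 0 (incoming m n b k) (b k).
rewrite h1 hsz; move=> <-; [|exact: incoming_sorted|lia].
by rewrite hT count_filter.
Qed.

(** The ends capped in a row are adjacent among its strands, so an arc under
    them has gone before. No arc of S(C) is missed, because the ends never
    capped are matched with bottom points. *)
Lemma caps_schedule b : (forall k, k < m -> b k <= n) ->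
  (forall k, k < m -> c (nth 0 (incoming m n b k) (b k)) =
                      nth 0 (incoming m n b k) (b k).+1) ->
  (forall i, i < n -> c (nth 0 (strands m n b m) i) = N + (n - i.+1)) ->
  exists2 P, schedule P & forall k, k < m -> caps_arc b P k.
Proof.
move=> hb hcap hend; pose P k := nth 0 (incoming m n b k) (b k).
have hb' k j : k <= m -> j < k -> b j <= n.
  by move=> hk hj; apply: hb; exact: leq_trans hj hk.
have hP k : k < m -> caps_arc b P k by move=> hk; split; rewrite /P ?hcap ?hb.
have hsz k : k < m -> size (incoming m n b k) = n.+2.
  by move=> hk; rewrite size_incoming size_strands // => j; apply/hb'/ltnW.
have hso k : k < m -> sorted ltn (incoming m n b k).
  by move=> hk; apply: incoming_sorted => // j; apply/hb'/ltnW.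
have inP k : k < m -> P k \in incoming m n b k.
  by move=> hk; rewrite mem_nth // hsz //; have := hb k hk; lia.
have incP k : k < m -> c (P k) \in incoming m n b k.
  by move=> hk; rewrite hcap // mem_nth // hsz // ltnS; apply: hb.
have range k x : k < m -> x \in incoming m n b k -> m - k.+1 <= x <= m + n + k.
  by move=> hk /incoming_range; apply=> // j; apply/hb'/ltnW.
have opP k : k < m -> P k < c (P k) < N.
  move=> hk; have := range k _ hk (incP k hk).
  have : P k < c (P k).
    rewrite hcap //; apply: (sorted_ltn_nth ltn_trans 0 (hso k hk)) => //;
    rewrite inE hsz //; have := hb k hk; lia.
  lia.
have alive k x : k < m -> x \in incoming m n b k -> ~~ gone P k x.
  move=> hk; have [_ /(_ hk)->] := strands_filter (ltnW hk)
    (fun j hj => hP j (ltn_trans hj hk)).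
  by rewrite mem_filter => /andP[].
have Pne j k : j < k -> k < m -> P k <> P j /\ P k <> c (P j).
  move=> hj hk; have /goneP h := alive k _ hk (inP k hk).
  by split=> e; apply: h; exists j => //; [left|right].
exists P => //; split.
- apply: uniq_perm.
  + rewrite map_inj_in_uniq ?iota_uniq // => j k; rewrite !mem_iota => hj hk e.
    case: (ltngtP j k) => // h; first by have [[]] := Pne j k h hk.
    by have [[]] := Pne k j h hj.
  + by rewrite filter_uniq ?iota_uniq.
  move=> x; apply/mapP/idP => [[k]|].
    by rewrite mem_iota mem_openers => hk ->; apply: opP.
  rewrite mem_openers => hx; have hxr : m - m <= x < m + n + m by lia.
  have [|[k hk [hxk|hxk]]] := strands_cover (hb' m ^~ (leqnn m)) (leqnn m) hxr.
  + case/(nthP 0) => i; rewrite size_strands; last by move=> j; apply: hb'.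
    by move=> hi ex; have := hend i hi; rewrite ex; lia.
  + by exists k => //; rewrite mem_iota.
  have := hcap k hk; rewrite -hxk -/(P k) => e; have hPk := opP k hk.
  have : c x = P k by rewrite -e cK //; lia.
  by lia.
- by move=> k hk; have := range k _ hk (incP k hk); have := range k _ hk (inP k hk); lia.
move=> j k hj hk hjk; rewrite ltnNge; apply/negP => hkj.
have hkj' : k < j.
  by rewrite ltn_neqAle hkj andbT; apply: contraTneq hjk => <-; rewrite ltnn.
have [h0 h1 h2] := hP k hk.
suff hin : P j \in incoming m n b k.
  by have := @sorted_nth_gap _ (b k) _ (hso k hk) _ hin; rewrite hsz // h1 h2 hjk => /(_ h0).
have [_ /(_ hk)->] := strands_filter (ltnW hk)
  (fun j hj => hP j (ltn_trans hj hk)).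
rewrite mem_filter mem_iota; apply/andP; split; last first.
  by have := range k _ hk (incP k hk); have := range k _ hk (inP k hk); lia.
apply/goneP => -[i hi hij]; have hij' := ltn_trans hi hkj'.
by have [] := Pne i j hij' hj; case: hij.
Qed.

Lemma sched_uncapped P j k : schedule P -> j < m -> k < m -> ~~ (j < k) ->
  ~~ gone P k (P j) /\ ~~ gone P k (c (P j)).
Proof.
move=> hP hj hk hjk; have oj := sched_opener hP hj.
split; apply/goneP => -[i hi]; have hi' : i < m := ltn_trans hi hk;
  have oi := sched_opener hP hi'.
- case=> e; first by have := sched_inj hP hj hi' e; lia.
  by have : c (P j) = P i; [rewrite e cK //; lia|lia].
case=> e; first by have := sched_opener hP hi'; rewrite -e cK //; lia.
have ee : P j = P i by rewrite -(@cK (P j)) ?e ?cK //; lia.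
by have := sched_inj hP hj hi' ee; lia.
Qed.

(** Conversely the ends of the arc scheduled for row k are adjacent there:
    any strand between them would belong to an arc under it that is capped
    later. The strands left at the end are sorted, so their partners on the
    bottom side are in decreasing order, which determines them. *)
Lemma schedule_caps P : schedule P ->
  (forall k, k < m -> caps_arc (left_alive P) P k) /\
  (forall i, i < n ->
     c (nth 0 (strands m n (left_alive P) m) i) = N + (n - i.+1)).
Proof.
move=> hP; set b := left_alive P.
have hcap k : k < m -> caps_arc b P k.
  elim/ltn_ind: k => k IH hk; have oP := sched_opener hP hk.
  have IH' j : j < k -> caps_arc b P j by move=> hj; apply: IH (ltn_trans hj hk).
  have [_ /(_ hk) hT] := strands_filter (ltnW hk) IH'.
  have hb j : j < k -> b j <= n by case/IH'.
  have hsz : size (incoming m n b k) = n.+2 by rewrite size_incoming size_strands.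
  have hso : sorted ltn (incoming m n b k) by apply: incoming_sorted.
  have [r1 r2] := sched_reach hP hk.
  have [g1 g2] := sched_uncapped hP hk hk (negbT (ltnn k)).
  have inT x : m - k.+1 <= x <= m + n + k -> ~~ gone P k x ->
      x \in incoming m n b k.
    by move=> hx hg; rewrite hT mem_filter hg mem_iota; lia.
  have in1 : P k \in incoming m n b k by apply: inT => //; lia.
  have in2 : c (P k) \in incoming m n b k by apply: inT => //; lia.
  have [i hi ei] : exists2 i, i < n.+2 & nth 0 (incoming m n b k) i = P k.
    by case/(nthP 0): in1 => i; rewrite hsz; exists i.
  have [j hj ej] : exists2 j, j < n.+2 & nth 0 (incoming m n b k) j = c (P k).
    by case/(nthP 0): in2 => j; rewrite hsz; exists j.
  have eb : b k = i.
    rewrite -(@count_lt_nth _ _ 0 (incoming m n b k) i) ?hsz // hT count_filter.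
    by rewrite -hT ei.
  have mono a d : a < n.+2 -> d < n.+2 ->
      (nth 0 (incoming m n b k) a < nth 0 (incoming m n b k) d) = (a < d).
    by move=> ha hd; apply: (lt_sorted_ltn_nth 0 hso); rewrite inE hsz.
  have hij : i < j by rewrite -mono // ei ej; lia.
  suff eji : j = i.+1 by split; rewrite eb -?eji //; lia.
  apply/eqP; rewrite eqn_leq hij andbT leqNgt; apply/negP => hgap.
  have hi1 : i.+1 < n.+2 by lia.
  have between : P k < nth 0 (incoming m n b k) i.+1 < c (P k).
    by rewrite -ej -ei !mono //; lia.
  have : nth 0 (incoming m n b k) i.+1 \in incoming m n b k by rewrite mem_nth ?hsz.
  rewrite {2}hT mem_filter => /andP[/goneP hg _]; apply: hg.
  move: between; set y := nth 0 _ i.+1 => between.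
  have yN : y < N + n by lia.
  have := c_nested between yN.
  have := openers_inner _ between; rewrite mem_openers => /(_ oP).
  case/orP=> /(sched_onto hP)[l hl el] nest.
    by exists l; [apply: (sched_nest hP) => //; rewrite -el|left].
  exists l; first by apply: (sched_nest hP) => //; rewrite -el.
  by right; rewrite -el cK.
split=> //.
have hb j : j < m -> b j <= n by case/hcap.
have [hS _] := strands_filter (leqnn m) hcap.
have hsz : size (strands m n b m) = n by apply: size_strands.
have far i : i < n -> nth 0 (strands m n b m) i < N /\
    N <= c (nth 0 (strands m n b m) i) < N + n.
  move=> hi; have : nth 0 (strands m n b m) i \in strands m n b m.
    by rewrite mem_nth ?hsz.
  move: (nth _ _ i) => x; rewrite hS mem_filter mem_iota => /andP[/goneP hg hx].
  have xN : x < N by lia.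
  have xN' : x < N + n by lia.
  split=> //; rewrite c_ltn // andbT leqNgt; apply/negP => hcx.
  have [] : x \in openers \/ c x \in openers.
  - by rewrite !mem_openers cK //; have := c_neq xN'; lia.
  - by case/(sched_onto hP) => l hl el; apply: hg; exists l => //; left.
  case/(sched_onto hP) => l hl el; apply: hg; exists l => //; right.
  by rewrite -el cK.
apply: decreasing_onto => [i /far[]//|i hi].
have [h1 h2] := far i (ltnW hi); have [h3 h4] := far _ hi.
have := @c_nested (nth 0 (strands m n b m) i) (nth 0 (strands m n b m) i.+1).
have : nth 0 (strands m n b m) i < nth 0 (strands m n b m) i.+1.
  apply: (sorted_ltn_nth ltn_trans 0) => //; rewrite ?inE ?hsz //; last exact: ltnW.
  exact: strands_sorted.
by lia.
Qed.

(** * The greedy schedule *)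

(** The arcs of S_1, by their left ends: the sum of the coordinates of x and
    c x is x + c x + 2 - 2 (m + n). *)
Definition rightward := [seq x <- openers | 2 * (m + n) <= x + c x + 1].
Definition leftward := [seq x <- openers | x + c x + 1 < 2 * (m + n)].
(** The rows of I_1, counted from zero: those whose right end closes an arc
    of S_1. *)
Definition closing_rows := [seq c x - (m + n) | x <- rightward].
Definition free_rows := [seq k <- iota 0 m | k \notin closing_rows].

Lemma mem_rightward x :
  (x \in rightward) = (x < c x < N) && (2 * (m + n) <= x + c x + 1).
Proof. by rewrite mem_filter mem_openers andbC. Qed.

Lemma mem_leftward x :
  (x \in leftward) = (x < c x < N) && (x + c x + 1 < 2 * (m + n)).
Proof. by rewrite mem_filter mem_openers andbC. Qed.

Lemma c_inj x y : x < N + n -> y < N + n -> c x = c y -> x = y.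
Proof. by move=> hx hy e; rewrite -(cK hx) e cK. Qed.

Lemma count_openers a :
  count a openers = count a rightward + count a leftward.
Proof.
rewrite /rightward /leftward; elim: openers => //= x s ->.
by case: ltnP => _ /=; lia.
Qed.

Lemma closing_rows_uniq : uniq closing_rows.
Proof.
rewrite map_inj_in_uniq ?filter_uniq ?iota_uniq // => x y.
rewrite !mem_rightward => hx hy e; apply: c_inj; lia.
Qed.

Lemma closing_rowsP k :
  reflect (k < m /\ c (m + n + k) \in rightward) (k \in closing_rows).
Proof.
apply: (iffP mapP) => [[x]|[hk hr]].
  rewrite mem_rightward => hx ->; split; first lia.
  by rewrite subnKC ?cK ?mem_rightward //; lia.
by exists (c (m + n + k)); rewrite // cK ?addKn //; lia.
Qed.

(** Each of the v top rows is free or is the row where an arc of S_1 closes;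
    this translates positions in the list of free rows into numbers of arcs. *)
Lemma count_free_rows v : v <= m ->
  count (fun k => k < v) free_rows +
  count (fun x => c x < m + n + v) rightward = v.
Proof.
move=> hv; have : count (fun k => k < v) (iota 0 m) = v.
  by rewrite count_ltn_iota; lia.
rewrite -(count_split _ (fun k => k \in closing_rows)) addnC -count_filter => e.
rewrite -[RHS]e; congr (_ + _); rewrite -(count_filter (fun k => k < v)).
have /permP-> : perm_eq [seq k <- iota 0 m | k \in closing_rows] closing_rows.
  apply: uniq_perm; rewrite ?filter_uniq ?iota_uniq ?closing_rows_uniq // => k.
  rewrite mem_filter mem_iota; case: closing_rowsP => // -[hk _]; lia.
rewrite count_map; apply: eq_in_count => x; rewrite mem_rightward /=; lia.
Qed.

Lemma size_free_rows : size openers = m -> size free_rows = size leftward.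
Proof.
have := count_free_rows (leqnn m); have := count_openers predT.
rewrite !count_predT => -> + hm.
have /eqP-> : count (fun k => k < m) free_rows == size free_rows.
  by rewrite -all_count; apply/allP => k; rewrite mem_filter mem_iota /=; lia.
have /eqP-> : count (fun x => c x < m + n + m) rightward == size rightward.
  by rewrite -all_count; apply/allP => x; rewrite mem_rightward /=; lia.
lia.
Qed.

(** By planarity the points under an arc are matched among themselves, so
    half of them are left ends. *)
Lemma count_inner x : x \in openers ->
  2 * count (fun y => x < y < c x) openers + x.+1 = c x.
Proof.
rewrite mem_openers => hx; pose s := iota x.+1 (c x - x.+1).
have hs y : (y \in s) = (x < y < c x) by rewrite mem_iota; lia.
have cs : perm_eq (map c s) s.
  have sub y : y \in s -> c y \in s.
    by rewrite !hs => hy; apply: c_nested => //; lia.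
  have u : uniq (map c s).
    by rewrite map_inj_in_uniq ?iota_uniq // => y z; rewrite !hs => hy hz; apply: c_inj; lia.
  apply: uniq_perm; rewrite ?iota_uniq // => y; apply/mapP/idP => [[z hz ->]|hy].
    exact: sub.
  by exists (c y); rewrite ?sub // cK //; move: hy; rewrite hs; lia.
(* The matching exchanges the left and the right ends in s. *)
have half : count (fun y => y < c y) s = count (fun y => ~~ (y < c y)) s.
  rewrite -(permP cs (fun y => ~~ (y < c y))) count_map; apply: eq_in_count => y.
  rewrite hs /= => hy; have hyN : y < N + n by lia.
  by rewrite cK //; have := c_neq hyN; lia.
have : count (fun y => y < c y) s + count (fun y => ~~ (y < c y)) s = size s.
  exact: count_predC.
rewrite -half size_iota -!size_filter.
have /perm_size-> : perm_eq [seq y <- s | y < c y] [seq y <- openers | x < y < c x].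
  apply: uniq_perm; rewrite ?filter_uniq ?iota_uniq // => y.
  rewrite !mem_filter mem_iota hs.
  case hy : (x < y < c x); rewrite ?andbF ?andbT //=.
  have := @c_nested x y hy; lia.
rewrite !size_filter; lia.
Qed.

Definition greedy (k : nat) : nat :=
  if k \in closing_rows then c (m + n + k)
  else nth 0 (rev leftward) (index k free_rows).

Lemma greedy_closing k : k \in closing_rows ->
  greedy k \in rightward /\ c (greedy k) = m + n + k.
Proof.
move=> hk; rewrite /greedy hk; have /closing_rowsP[hkm hr] := hk.
by split=> //; rewrite cK //; lia.
Qed.

Lemma leftward_sorted : sorted ltn leftward.
Proof. by do 2!apply: (sorted_filter ltn_trans); apply: iota_ltn_sorted. Qed.

Lemma free_rows_sorted : sorted ltn free_rows.
Proof. by apply: (sorted_filter ltn_trans); apply: iota_ltn_sorted. Qed.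

Lemma mem_free_rows k : (k \in free_rows) = (k < m) && (k \notin closing_rows).
Proof. by rewrite mem_filter mem_iota andbC. Qed.

Section Greedy.
Variable P : nat -> nat.
Hypothesis hP : schedule P.

Lemma sched_size : size openers = m.
Proof. by rewrite -(perm_size (sched_perm hP)) size_map size_iota. Qed.

(** The rank of a free row among the free rows is the rank of its arc among
    the arcs of S_2 from the right. All later arguments use this equality of
    counts instead of positions in lists. *)
Lemma greedy_free k : k < m -> k \notin closing_rows ->
  greedy k \in leftward /\
  count (fun j => j < k) free_rows = count (fun x => greedy k < x) leftward.
Proof.
move=> hk hkc; have hkf : k \in free_rows by rewrite mem_free_rows hk.
have hi : index k free_rows < size leftward.
  by rewrite -(size_free_rows sched_size) index_mem.
rewrite /greedy (negbTE hkc); set i := index k free_rows in hi *.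
rewrite nth_rev //; set l := size leftward - i.+1.
have hl : l < size leftward by rewrite /l; lia.
split; first exact: mem_nth.
have -> : count (fun j => j < k) free_rows = i.
  rewrite -{1}(nth_index 0 hkf) -[RHS](@count_lt_nth _ _ 0 free_rows i) //.
  - exact: free_rows_sorted.
  - by rewrite index_mem.
have h1 := @count_lt_nth _ _ 0 leftward l leftward_sorted hl.
have := count_predC (fun x => nth 0 leftward l < x) leftward.
have -> : count (predC (fun x => nth 0 leftward l < x)) leftward = l.+1.
  have := @count_le_nth _ _ 0 leftward l leftward_sorted hl => <-.
  by apply: eq_count => x /=; rewrite -leqNgt.
by rewrite /l; lia.
Qed.

Lemma greedy_free_lt j k : j < k -> k < m ->
  j \notin closing_rows -> k \notin closing_rows -> greedy k < greedy j.
Proof.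
move=> hjk hk hj hkc; have hjm := ltn_trans hjk hk.
have [_ e1] := greedy_free hjm hj; have [_ e2] := greedy_free hk hkc.
rewrite ltnNge; apply/negP => h.
have h1 : count (fun i => i < j) free_rows < count (fun i => i < k) free_rows.
  apply: (@count_sub_lt _ _ _ _ j); rewrite ?mem_free_rows ?hjm ?ltnn // => i _; lia.
have : count (fun x => greedy k < x) leftward <= count (fun x => greedy j < x) leftward.
  by apply: count_sub => x _; lia.
lia.
Qed.

Lemma greedy_opener k : k < m -> greedy k < c (greedy k) < N.
Proof.
move=> hk; case hkc : (k \in closing_rows).
  by have [] := greedy_closing hkc; rewrite mem_rightward => /andP[].
by have [] := greedy_free hk (negbT hkc); rewrite mem_leftward => /andP[].
Qed.

Lemma greedy_perm : perm_eq (map greedy (iota 0 m)) openers.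
Proof.
have u : uniq (map greedy (iota 0 m)).
  rewrite map_inj_in_uniq ?iota_uniq // => j k; rewrite !mem_iota /= !add0n.
  wlog : j k / j < k => [hw|hjk hj hk e].
    by move=> hj hk e; case: (ltngtP j k) => // h; [apply: hw|apply/esym/hw].
  case hjc : (j \in closing_rows); case hkc : (k \in closing_rows).
  - have [_] := greedy_closing hjc; have [_] := greedy_closing hkc.
    rewrite e; lia.
  - have [] := greedy_closing hjc; have [] := greedy_free hk (negbT hkc).
    rewrite -e mem_leftward mem_rightward; lia.
  - have [] := greedy_closing hkc; have [] := greedy_free hj (negbT hjc).
    rewrite -e mem_leftward mem_rightward; lia.
  have := greedy_free_lt hjk hk (negbT hjc) (negbT hkc); lia.
have [] := @uniq_min_size _ (map greedy (iota 0 m)) openers u.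
- move=> x /mapP[k]; rewrite mem_iota => hk ->.
  by rewrite mem_openers; apply: greedy_opener.
- by rewrite sched_size size_map size_iota.
by move=> _ h; apply: uniq_perm => //; rewrite filter_uniq ?iota_uniq.
Qed.

(** The first v rows consist of the rows where S_1 arcs close and of free
    rows. As many free rows precede k as there are S_2 arcs to the right of
    greedy k, and k is one more. *)
Lemma free_rank_lt k v : k < v -> v <= m -> k \notin closing_rows ->
  count (fun x => greedy k < x) leftward +
  count (fun x => c x < m + n + v) rightward < v.
Proof.
move=> hkv hv hkc; have hk : k < m by lia.
have [_ <-] := greedy_free hk hkc.
have := count_free_rows hv.
have : count (fun i => i < k) free_rows < count (fun i => i < v) free_rows.
  apply: (@count_sub_lt _ _ _ _ k); rewrite ?mem_free_rows ?hk ?ltnn // => i _; lia.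
lia.
Qed.

(** If the row k of an S_2 arc were above its right end c x, then by
    [free_rank_lt] the arcs under (x, c x) would be fewer than the rows above
    c x. But x and c x have coordinates with a sum of at most 0, so at least
    as many arcs as that lie under (x, c x). *)
Lemma greedy_right_end k : k < m -> c (greedy k) <= m + n + k.
Proof.
move=> hk; case hkc : (k \in closing_rows).
  by have [_ ->] := greedy_closing hkc.
have [hx _] := greedy_free hk (negbT hkc); set x := greedy k in hx *.
rewrite leqNgt; apply/negP => hlt; rewrite mem_leftward in hx.
have hv : c x - (m + n) <= m by lia.
have hkv : k < c x - (m + n) by lia.
have := free_rank_lt hkv hv (negbT hkc); rewrite -/x subnKC; last lia.
have hxo : x \in openers by rewrite mem_openers; lia.
have := count_inner hxo; rewrite count_openers.
have : count (fun y => x < y < c x) leftward <= count (fun y => x < y) leftward.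
  by apply: count_sub => y _; lia.
have : count (fun y => x < y < c x) rightward <= count (fun y => c y < c x) rightward.
  by apply: count_sub => y _ hy; have := @c_nested x y hy; lia.
lia.
Qed.

(** If row k were above the first row where the left end x is present, then
    by [free_rank_lt] the arcs that can be capped above that row, either S_2
    arcs to the right of x or S_1 arcs that close there, would be fewer than
    the rows above it. But P caps one of them in each of these rows. *)
Lemma greedy_left_end k : k < m -> m <= greedy k + k.+1.
Proof.
move=> hk; case hkc : (k \in closing_rows).
  by have [] := greedy_closing hkc; rewrite mem_rightward; lia.
have [hx _] := greedy_free hk (negbT hkc); set x := greedy k in hx *.
rewrite leqNgt; apply/negP => hlt; rewrite mem_leftward in hx.
pose v := m - x.+1; have hkv : k < v by rewrite /v; lia.
have hv : v <= m by rewrite /v; lia.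
have := free_rank_lt hkv hv (negbT hkc); rewrite -/x ltnNge => /negP; apply.
(* The arcs that P caps in the first v rows: those of S_1 close there, and
   those of S_2 start to the right of x. *)
pose a y := if 2 * (m + n) <= y + c y + 1 then c y < m + n + v else x < y.
have : size (map P (iota 0 v)) <= size [seq y <- openers | a y].
  apply: uniq_leq_size => [|y /mapP[j]].
    rewrite map_inj_in_uniq ?iota_uniq // => i j; rewrite !mem_iota => hi hj.
    by apply: (sched_inj hP); lia.
  rewrite mem_iota => hj ->; have hjm : j < m by lia.
  have := sched_opener hP hjm; have := sched_reach hP hjm.
  by rewrite mem_filter mem_openers /a; case: ifP => _; rewrite /v in hj; lia.
rewrite size_map size_iota size_filter count_openers addnC => hva.
apply: leq_trans hva _; apply: leq_add; apply: count_sub => y.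
  by rewrite mem_leftward /a [X in _ && X]ltnNge => /andP[_ /negbTE->].
by rewrite mem_rightward /a => /andP[_ ->].
Qed.

(** The case that needs a count is an S_2 arc under an S_1 arc (x, c x). The
    S_2 arcs from the former to the right, itself included, and the S_1 arcs
    that close above c x all lie under (x, c x). As x and c x have
    coordinates with a positive sum, the arcs under it do not outnumber the
    rows above c x, so the S_2 arc has its turn in one of these. *)
Lemma greedy_nest j k : j < m -> k < m ->
  greedy k < greedy j < c (greedy k) -> j < k.
Proof.
move=> hj hk; have ok := greedy_opener hk; have oj := greedy_opener hj.
move=> hjk; have nest : greedy k < c (greedy j) < c (greedy k).
  by apply: c_nested => //; lia.
case hjc : (j \in closing_rows).
  have [_ e] := greedy_closing hjc; have := greedy_right_end hk; lia.
have [hz ez] := greedy_free hj (negbT hjc); rewrite mem_leftward in hz.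
rewrite ltnNge leq_eqVlt; apply/negP => /orP[/eqP e|hkj].
  by rewrite e ltnn in hjk.
case hkc : (k \in closing_rows); last first.
  by have := greedy_free_lt hkj hj (negbT hkc) (negbT hjc); lia.
have [hx ex] := greedy_closing hkc; rewrite mem_rightward in hx.
set x := greedy k in ok hjk nest hx ex *; set z := greedy j in oj hjk nest hz ez *.
have hxo : x \in openers by rewrite mem_openers.
have := count_inner hxo; rewrite count_openers.
have : count (fun y => z < y) leftward < count (fun y => x < y < c x) leftward.
  apply: (@count_sub_lt _ _ _ _ z); rewrite ?mem_leftward ?ltnn // => y.
  by rewrite mem_leftward; lia.
have : count (fun y => c y < m + n + k) rightward <=
    count (fun y => x < y < c x) rightward.
  apply: count_sub => y; rewrite mem_rightward => hy hcy.
  case: (ltngtP x y) => [|hyx|exy]; [lia| |by rewrite exy in ex; lia].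
  by have := @c_nested y x; lia.
have : count (fun i => i < k) free_rows <= count (fun i => i < j) free_rows.
  by apply: count_sub => i _; lia.
have := count_free_rows (ltnW hk); lia.
Qed.

Lemma greedy_schedule : schedule greedy.
Proof.
split; [exact: greedy_perm| |exact: greedy_nest].
by move=> k hk; rewrite greedy_left_end ?greedy_right_end.
Qed.

(** * Optimality *)

(** The sum of the coordinates of the arc minus 1 on S_1, and 0 on S_2. *)
Definition excess x := x + c x + 1 - 2 * (m + n).

Lemma left_alive_leq Q k : schedule Q -> k < m -> left_alive Q k <= n.
Proof. by move=> hQ hk; have [/(_ k hk)[]] := schedule_caps hQ. Qed.

(** For an arc of S_1 the alive ends to the left number at most n, and the
    row is not above the right end. *)
Lemma excess_left_gone Q k : schedule Q -> k < m -> excess (Q k) <= left_gone Q k.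
Proof.
move=> hQ hk; have := left_alive_leq hQ hk; have := left_countE hQ hk.
by have := sched_reach hQ hk; rewrite /excess; lia.
Qed.

(** An S_1 arc is capped when its right end is the last strand of the row, so
    exactly n strands precede it. To the left of an S_2 arc nothing has gone:
    the other S_2 arcs there come later, an S_1 arc cannot lie entirely to
    the left because its coordinates have a larger sum, and an S_1 arc around
    it comes later as well. *)
Lemma left_gone_greedy k : k < m -> left_gone greedy k = excess (greedy k).
Proof.
move=> hk; have hG := greedy_schedule; have := left_countE hG hk.
case hkc : (k \in closing_rows).
  have [hx ex] := greedy_closing hkc.
  have [/(_ k hk)[h0 h1 h2] _] := schedule_caps hG.
  (* The right end m + n + k is the last of the n + 2 strands of its row. *)
  suff -> : left_alive greedy k = n by rewrite mem_rightward in hx; rewrite /excess; lia.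
  apply/eqP; rewrite eqn_leq h0 /= leqNgt; apply/negP => hlt.
  have hb j : j < k -> left_alive greedy j <= n.
    by move=> hj; apply: left_alive_leq => //; exact: ltn_trans hj hk.
  have : nth 0 (incoming m n (left_alive greedy) k) (left_alive greedy k).+1 <
         nth 0 (incoming m n (left_alive greedy) k) n.+1.
    apply: (sorted_ltn_nth ltn_trans 0 (incoming_sorted hb hk)) => //;
      by rewrite inE size_incoming size_strands // ltnS ltnW.
  by rewrite h2 ex nth_incoming // ltnn ltnn.
move=> _; have [hx _] := greedy_free hk (negbT hkc); rewrite mem_leftward in hx.
rewrite /excess (_ : _ - _ = 0); last lia.
apply/eqP; rewrite -leqn0 leqNgt -has_count; apply/hasPn => y _.
apply/negP => /andP[hy /goneP[j hj hyj]]; have hjm := ltn_trans hj hk.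
have oj := greedy_opener hjm.
have hjk : greedy j < greedy k by lia.
case hjc : (j \in closing_rows); last first.
  by have := greedy_free_lt hj hk (negbT hjc) (negbT hkc); lia.
have [] := greedy_closing hjc; rewrite mem_rightward => hz _.
case: (ltngtP (c (greedy j)) (greedy k)) => h.
- lia.
- by have := greedy_nest hk hjm; rewrite hjk h => /(_ isT); lia.
by move: hx; rewrite -h cK; lia.
Qed.

Lemma sum_openers (F : nat -> nat) Q : schedule Q ->
  \sum_(x <- openers) F x = \sum_(k < m) F (Q k).
Proof.
move=> hQ; rewrite -(perm_big _ (sched_perm hQ)) big_map.
by rewrite -(big_mkord predT (fun k => F (Q k))) /index_iota subn0.
Qed.

(** The right-hand side does not depend on the schedule, so a large norm
    means few gone ends. *)
Lemma sum_left_count Q : schedule Q ->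
  \sum_(k < m) left_alive Q k + \sum_(k < m) left_gone Q k + \sum_(k < m) m =
  \sum_(x <- openers) x + \sum_(k < m) k.+1.
Proof.
move=> hQ; rewrite (sum_openers id hQ) -!big_split.
by apply: eq_bigr => k _; apply: left_countE.
Qed.

(** The excess is a lower bound for each row, and the sum of these bounds is
    attained by the greedy schedule. *)
Lemma max_left_gone : 
  \sum_(k < m) left_alive greedy k <= \sum_(k < m) left_alive P k ->
  forall k, k < m -> left_gone P k = excess (P k).
Proof.
move=> hmax; have := sum_left_count hP; rewrite -(sum_left_count greedy_schedule).
have -> : \sum_(k < m) left_gone greedy k = \sum_(k < m) excess (P k).
  rewrite -(sum_openers _ hP) (sum_openers _ greedy_schedule).
  by apply: eq_bigr => k _; apply: left_gone_greedy.
move=> e; have hle : \sum_(k < m) left_gone P k <= \sum_(k < m) excess (P k) by lia.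
have hif : \sum_(k < m) excess (P k) <= \sum_(k < m) left_gone P k
    ?= iff [forall (k : 'I_m | true), excess (P k) == left_gone P k].
  by apply: leqif_sum => k _; split=> //; apply: excess_left_gone.
move=> k hk; move: hle; rewrite (geq_leqif hif) => /forallP/(_ (Ordinal hk)).
by move/eqP->.
Qed.

End Greedy.

Section Maximal.
Variable P : nat -> nat.
Hypothesis hP : schedule P.
Hypothesis hmax : forall Q, schedule Q ->
  \sum_(k < m) left_alive Q k <= \sum_(k < m) left_alive P k.

Let tight k : k < m -> left_gone P k = excess (P k).
Proof. by move=> hk; apply: max_left_gone => //; apply/hmax/(greedy_schedule hP). Qed.

Lemma max_rightward k : k < m -> P k \in rightward ->
  k = c (P k) - (m + n) /\ left_alive P k = n.
Proof.
move=> hk; have := left_countE hP hk; rewrite tight // mem_rightward /excess.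
have := sched_reach hP hk; have := left_alive_leq hP hk; lia.
Qed.

Lemma max_closing k : k \in closing_rows -> k < m /\ P k \in rightward.
Proof.
move=> /closing_rowsP[hk hr]; split=> //.
have [j hj e] : exists2 j, j < m & c (m + n + k) = P j.
  by apply: sched_onto => //; move: hr; rewrite mem_filter => /andP[].
have := @max_rightward j hj; rewrite -e => /(_ hr)[+ _].
by rewrite cK ?addKn; [move=> <-; rewrite -e|lia].
Qed.

Lemma max_free k : k < m -> k \notin closing_rows -> 
  P k \in leftward /\ left_alive P k + m = P k + k.+1.
Proof.
move=> hk hkc; have oP := sched_opener hP hk.
case hr : (P k \in rightward).
  have [ek _] := max_rightward hk hr; case/negP: hkc; apply/closing_rowsP.
  by split=> //; rewrite ek subnKC ?cK //; move: hr; rewrite mem_rightward; lia.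
have hl : P k \in leftward by move: hr; rewrite mem_leftward mem_rightward oP; lia.
split=> //; have := left_countE hP hk; rewrite tight // /excess.
by move: hl; rewrite mem_leftward; lia.
Qed.

(** If the S_2 arc further left went first, its left end would be a gone end
    to the left of the other arc, whose count of gone ends is zero. *)
Lemma max_free_lt j k : j < k -> k < m ->
  j \notin closing_rows -> k \notin closing_rows -> P k < P j.
Proof.
move=> hjk hk hjc hkc; have hj := ltn_trans hjk hk.
case: (ltngtP (P k) (P j)) => // h; last by have := sched_inj hP hk hj h; lia.
have [hl e] := max_free hk hkc.
have : 0 < left_gone P k.
  rewrite -has_count; apply/hasP; exists (P j).
    have := sched_reach hP hj; have := sched_reach hP hk.
    by have := sched_opener hP hk; rewrite mem_iota; lia.
  by rewrite h; apply/goneP; exists j => //; left.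
by rewrite tight // /excess; move: hl; rewrite mem_leftward; lia.
Qed.

(** Both lists are decreasing and have the same entries. *)
Lemma max_free_rows : map P free_rows = rev leftward.
Proof.
have sortedP : sorted gtn (map P free_rows).
  apply: (homo_sorted_in (e := ltn) (P := [pred k | (k < m) && (k \notin closing_rows)])).
  - move=> j k; rewrite !inE => /andP[_ hjc] /andP[hk hkc] hjk.
    exact: max_free_lt.
  - by apply/allP => k; rewrite mem_free_rows.
  - exact: free_rows_sorted.
have gtn_trans : transitive gtn by move=> y x z h1 h2; apply: ltn_trans h2 h1.
have gtn_irr : irreflexive gtn by move=> x; apply: ltnn.
apply: (irr_sorted_eq gtn_trans gtn_irr) => //.
  by rewrite rev_sorted; apply: leftward_sorted.
apply: (snd (uniq_min_size _ _ _)).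
- exact: sorted_uniq gtn_trans gtn_irr _ sortedP.
- move=> x /mapP[k]; rewrite mem_rev mem_free_rows => /andP[hk hkc] ->.
  by have [] := max_free hk hkc.
- by rewrite size_rev size_map size_free_rows // (sched_size hP).
Qed.

End Maximal.
End Matching.

(** * Back to Catalan states *)

Section Translation.
Variables (m n : nat) (C : catalan m n).
Hypothesis hbot : no_bottom_returns C.
Local Notation c := (mate C).
Local Notation right := (rightward m n c).
Local Notation left := (leftward m n c).
Local Notation closing := (closing_rows m n c).
Local Notation free := (free_rows m n c).

Lemma strands_ext (b b' : nat -> nat) k : (forall j, j < k -> b j = b' j) ->
  strands m n b k = strands m n b' k.
Proof.
elim: k => //= k IH h; rewrite IH ?h // => j hj; exact: h (ltnW hj).
Qed.

Lemma row_nat_ffun (b : nat -> nat) k : k < m -> b k <= n ->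
  row_nat [ffun j : 'I_m => inord (b j) : 'I_n.+1] k = b k.
Proof.
by move=> hk hb; rewrite (row_nat_ord _ (Ordinal hk)) ffunE inordK.
Qed.

(** The maximum defining a maximal sequence ranges over sequences; this turns
    every schedule into a competitor. *)
Lemma schedule_realizable Q : schedule m n c Q ->
  exists2 r : row_seq m n, r \in realizing_seqs C &
    seq_norm r = \sum_(k < m) left_alive m n c Q k.
Proof.
move=> hQ; set b := left_alive m n c Q.
have [hcap hend] := schedule_caps (@mateK _ _ C) (@mate_ltn _ _ C)
  (@mate_neq _ _ C) (@mate_nested _ _ C) hQ.
pose r : row_seq m n := [ffun j : 'I_m => inord (b j)].
have hr k : k < m -> row_nat r k = b k.
  by move=> hk; apply: row_nat_ffun => //; have [] := hcap k hk.
have hS k : k <= m -> strands m n (row_nat r) k = strands m n b k.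
  by move=> hk; apply: strands_ext => j hj; apply: hr; exact: leq_trans hj hk.
exists r.
  rewrite inE; apply: caps_match_realizes => //; split=> [k hk|i hi]; last first.
    by rewrite hS // hend.
  rewrite /incoming hS ?(ltnW hk) // hr //.
  by have [_ -> ->] := hcap k hk.
by apply: eq_bigr => j _; rewrite -row_nat_ord hr.
Qed.

Lemma maximal_schedule b : maximal_sequence C b ->
  exists P, [/\ schedule m n c P,
    (forall k, k < m -> row_nat b k = left_alive m n c P k) &
    forall Q, schedule m n c Q -> \sum_(k < m) left_alive m n c Q k <=
                                  \sum_(k < m) left_alive m n c P k].
Proof.
move=> [hb hmax]; have : caps_match b C.
  by apply: realizes_caps_match; move: hb; rewrite inE.
move=> [hcap hend].
have [P hP hPb] := caps_schedule (@mateK _ _ C)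
  (fun k _ => row_nat_leq b k) hcap hend.
have eb k : k < m -> row_nat b k = left_alive m n c P k.
  move=> hk; apply: (caps_alive hk) => j hj; apply: hPb; exact: leq_ltn_trans hj hk.
exists P; split=> // Q /schedule_realizable[r hr <-].
have -> : \sum_(k < m) left_alive m n c P k = seq_norm b.
  by apply: eq_bigr => j _; rewrite -eb ?row_nat_ord.
by rewrite hmax; apply: leq_bigmax_cond.
Qed.

Local Open Scope fset_scope.
Local Open Scope ring_scope.

(** The coordinate of a point off the bottom side in terms of its clockwise
    number. *)
Definition coord (x : nat) : int := x%:Z + 1 - (m + n)%:Z.

Lemma iota_mn_coord (p : bpoint m n) : ~~ is_bottom p -> iota_mn p = coord (bpos p).
Proof. by case: p => // i _; rewrite /coord /=; have := ltn_ord i; lia. Qed.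

Lemma mem_arcsS (p q : bpoint m n) : ((p, q) \in arcsS C) =
  [&& C p == q, (bpos p < c (bpos p))%N & (c (bpos p) < m + n + m)%N].
Proof.
rewrite inE /= mate_bpos; case: eqP => //= <-.
case hp : (is_bottom p).
  by move: hp; rewrite bpos_bottom; lia.
case hq : (is_bottom (C p)); first by move: hq; rewrite bpos_bottom; lia.
rewrite !iota_mn_coord ?hp ?hq // /coord.
by move: hp hq; rewrite !bpos_bottom; lia.
Qed.

Lemma mem_arcsS1 (p q : bpoint m n) :
  ((p, q) \in arcsS1 C) = (C p == q) && (bpos p \in right).
Proof.
rewrite inE mem_arcsS mem_rightward; case: eqP => //= <-.
case: (boolP (bpos p < c (bpos p) < m + n + m)%N) => //= hp.
rewrite !iota_mn_coord ?bpos_bottom -?mate_bpos; try lia.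
by rewrite /coord; lia.
Qed.

Lemma mem_arcsS2 (p q : bpoint m n) :
  ((p, q) \in arcsS2 C) = (C p == q) && (bpos p \in left).
Proof.
rewrite inE mem_arcsS1 mem_arcsS mem_rightward mem_leftward.
by case: eqP => //= _; lia.
Qed.

Lemma bpos_in x : (x < m + n + m)%N -> exists p : bpoint m n, bpos p = x.
Proof. by move=> hx; apply: bpos_surj; lia. Qed.

Lemma card_arcsS2 : #|arcsS2 C| = size left.
Proof.
rewrite cardE -(size_map (fun a => bpos a.1)); apply/perm_size/uniq_perm.
- rewrite map_inj_in_uniq ?enum_uniq // => -[p q] [p' q'].
  rewrite !mem_enum !mem_arcsS2 /= => /andP[/eqP<- _] /andP[/eqP<- _].
  by move/bpos_inj => ->.
- by rewrite !filter_uniq ?iota_uniq.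
move=> x; apply/mapP/idP => [[[p q]]|hx].
  by rewrite mem_enum mem_arcsS2 /= => /andP[_ h] ->.
have [|p hp] := @bpos_in x; first by move: hx; rewrite mem_leftward; lia.
by exists (p, C p); rewrite // mem_enum mem_arcsS2 eqxx hp.
Qed.

Lemma mem_I1 (j : 'I_m) : (row_label j \in I1 C) = ((j : nat) \in closing).
Proof.
apply/imfsetP/mapP => [[[p q]]|[x hx ej]].
  rewrite /= mem_arcsS1 => /andP[/eqP <- hp] e; exists (bpos p) => //.
  move: hp e; rewrite mem_rightward mate_bpos => hp.
  rewrite iota_mn_coord ?bpos_bottom; last lia.
  by rewrite /row_label /coord; lia.
have hx' := hx; rewrite mem_rightward in hx'.
have [|p hp] := @bpos_in x; first by lia.
exists (p, C p); first by rewrite /= mem_arcsS1 eqxx hp.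
rewrite /= iota_mn_coord ?bpos_bottom -mate_bpos hp; last lia.
by rewrite /row_label /coord ej; lia.
Qed.

Lemma ascending_I2 : ascending (I2 C) = [seq k.+1%:Z | k <- free].
Proof.
apply: (@sorted_eq _ <=%R le_trans le_anti).
- exact/sort_sorted/le_total.
- apply: (homo_sorted (e := ltn)) (free_rows_sorted m n c) => j k /=; lia.
rewrite /ascending perm_sort; apply: uniq_perm; first exact: fset_uniq.
  rewrite map_inj_uniq ?filter_uniq ?iota_uniq // => j k [] //.
move=> z; rewrite in_fsetD; apply/andP/mapP => [[hz /imfsetP[j _ e]]|[k + ->]].
  by exists (j : nat); rewrite // mem_free_rows ltn_ord -mem_I1 -e.
rewrite mem_free_rows => /andP[hk hkc]; split.
  by rewrite (mem_I1 (Ordinal hk)).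
by apply/imfsetP; exists (Ordinal hk).
Qed.

Lemma descending_I3 : descending (I3 C) = [seq coord x | x <- rev left].
Proof.
apply: (@sorted_eq _ >=%R ge_trans ge_anti).
- exact/sort_sorted/ge_total.
- have : sorted gtn (rev left) by rewrite rev_sorted; apply: leftward_sorted.
  by apply: homo_sorted => x y; rewrite /coord /=; lia.
rewrite /descending perm_sort; apply: uniq_perm; first exact: fset_uniq.
  rewrite map_inj_uniq ?rev_uniq ?filter_uniq ?iota_uniq // => x y.
  by rewrite /coord; lia.
move=> z; apply/imfsetP/mapP => [[[p q]]|[x + ->]].
  rewrite /= mem_arcsS2 => /andP[_ hp] ->; exists (bpos p); rewrite ?mem_rev //.
  by rewrite iota_mn_coord // bpos_bottom; move: hp; rewrite mem_leftward; lia.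
rewrite mem_rev => hx; have hx' := hx; rewrite mem_leftward in hx'.
have [|p hp] := @bpos_in x; first by lia.
exists (p, C p); first by rewrite /= mem_arcsS2 eqxx hp.
by rewrite /= iota_mn_coord ?bpos_bottom hp; lia.
Qed.

End Translation.

Local Open Scope fset_scope.
Local Open Scope ring_scope.

Theorem corollary4p11 (m n : nat) (C : catalan m n) (b : row_seq m n)
    (hC : realizable C) (hbot : no_bottom_returns C)
    (hb : maximal_sequence C b) :
  let s : nat := #|arcsS2 C| in
  let i : seq int := ascending (I2 C) in
  let l : seq int := descending (I3 C) in
  [/\ size i = s,
      size l = s,
      (forall j : 'I_m, row_label j \in I1 C -> (b j : nat) = n)
    & (forall (k : nat) (j : 'I_m), (k < s)%N -> row_label j = i`_k ->
         (b j)%:Z = n%:Z + (i`_k - 1) + l`_k)].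
Proof.
move=> s i l.
have [P [hP eb hmax]] := maximal_schedule hbot hb.
have cK := @mateK _ _ C; have c_lt := @mate_ltn _ _ C.
have c_ne := @mate_neq _ _ C; have c_nest := @mate_nested _ _ C.
have hsz := size_free_rows cK (sched_size hP).
rewrite /i /l /s ascending_I2 descending_I3 card_arcsS2 !size_map size_rev hsz.
split=> // [j|k j hk].
  rewrite mem_I1 => /(max_closing cK c_lt c_ne c_nest hP hmax)[hj hr].
  have [_ e] := max_rightward cK c_lt c_ne c_nest hP hmax hj hr.
  by rewrite -row_nat_ord eb.
rewrite -(max_free_rows cK c_lt c_ne c_nest hP hmax) -map_comp.
rewrite !(nth_map 0) ?hsz //; set r := nth 0%N _ k => ej.
have hr : r \in free_rows m n (mate C) by rewrite mem_nth ?hsz.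
have ejr : (j : nat) = r by move: ej; rewrite /row_label; lia.
rewrite mem_free_rows -ejr in hr; have /andP[hj hjc] := hr.
have [_] := max_free cK c_lt c_ne c_nest hP hmax hj hjc.
by rewrite -eb // row_nat_ord /= -ejr /coord; lia.
Qed.
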